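(* Let $z(x;w)\in\mathbb{R}^C$ denote the logits of a classification network with parameters $w\in\mathbb{R}^d$ on input $x$, differentiable in $w$, and assume there exists $G>0$ such that $\|\nabla_w z(x;w)\|_{\mathrm{op}}\le G$ for all $(x,w)$. Let $w_t\in\mathbb{R}^d$ be the global model parameters. For each forget sample $(x_i,y_i)$ let the virtual teacher be $\mathbf{p}^{\mathrm{virt}}_i=\mathrm{softmax}(\mathbf{z}^{\mathrm{virt}}_i)$, where $z^{\mathrm{virt}}_{i,y_i}=v$ for a value $v\in\mathbb{R}$ and $z^{\mathrm{virt}}_{i,c}=z(x_i;w_t)_c$ for $c\neq y_i$. Let the student perform $T_u$ stochastic knowledge-distillation updates with learning rate $\eta_u>0$ on batches of $B$ forget samples, starting from $w_t$, and let $w^{\bar u}$ be the resulting parameters. Then $$\|w^{\bar u}-w_t\|\ \le\ \eta_u\,G\,\sqrt{2}\,T_u .$$ The same bound holds when the fixed value $v$ is replaced by the per-sample choice $v_i=\min_{c}z(x_i;w_t)_c$.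
   Context: $\mathrm{softmax}(\mathbf{z})_c=e^{z_c}/\sum_{j=1}^C e^{z_j}$ and $\mathrm{KL}(\mathbf{p}\|\mathbf{q})=\sum_c p_c\log(p_c/q_c)$. $\|\cdot\|$ is the Euclidean norm, $\nabla_w z(x;w)$ is the Jacobian of the logits with respect to $w$, and $\|\cdot\|_{\mathrm{op}}$ is the operator norm. Stochastic knowledge-distillation update: given the current student parameters $w^s$ and a batch $\{(x_i,y_i)\}_{i=1}^B$ of forget samples, set $w^s\leftarrow w^s-\eta_u\nabla_{w^s}\mathcal{L}_{\mathrm{KD}}$ with $$\mathcal{L}_{\mathrm{KD}}=\frac1B\sum_{i=1}^B\mathrm{KL}\big(\mathbf{p}^{\mathrm{virt}}_i\,\|\,\mathrm{softmax}(z(x_i;w^s))\big),$$ where the teacher distributions $\mathbf{p}^{\mathrm{virt}}_i$ are computed from the fixed global model $w_t$ and do not depend on $w^s$. The batch may change from one update to the next. *)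

(* Defs.v *)
From mathcomp Require Import all_boot all_order all_algebra.
From mathcomp Require Import all_classical all_reals all_analysis.
Import Order.TTheory GRing.Theory Num.Theory.
Import numFieldNormedType.Exports.

Set Implicit Arguments.
Unset Strict Implicit.
Unset Printing Implicit Defensive.

Local Open Scope classical_set_scope.
Local Open Scope ring_scope.

(* The library norm `|u| of a row vector is the sup norm. *)
Definition l2norm (R : realType) (n : nat) (u : 'rV[R]_n) : R :=
  Num.sqrt (\sum_(j < n) u ord0 j ^+ 2).

(* A acts on row vectors by v |-> v *m A, and the library Jacobian satisfies
   v *m 'J f w = 'd f w v: it is the transpose of the usual Jacobian matrix,
   so [opnorm ('J f w)] is the Euclidean operator norm of the differential. *)
Definition opnorm (R : realType) (m n : nat) (A : 'M[R]_(m, n)) : R :=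
  sup [set l2norm (v *m A) | v in [set v : 'rV[R]_m | l2norm v <= 1]].

Definition gradient (R : realType) (d : nat) (f : 'rV[R]_d -> R)
    (w : 'rV[R]_d) : 'rV[R]_d :=
  \row_(j < d) 'D_(delta_mx ord0 j) f w.

Definition softmax (R : realType) (C : nat) (u : 'rV[R]_C) : 'rV[R]_C :=
  \row_(c < C) (expR (u ord0 c) / \sum_(j < C) expR (u ord0 j)).

Definition KL (R : realType) (C : nat) (p q : 'rV[R]_C) : R :=
  \sum_(c < C) p ord0 c * ln (p ord0 c / q ord0 c).

Section Distillation.
Variables (R : realType) (X : Type) (C d : nat).
Variable z : X -> 'rV[R]_d -> 'rV[R]_C.
Variable wt : 'rV[R]_d.

(* A sample is a pair (input, label). The map v chooses the logit that
   replaces the one of the true class. *)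
Definition virtual_logits (v : X * 'I_C -> R) (s : X * 'I_C) : 'rV[R]_C :=
  \row_(c < C) if c == s.2 then v s else z s.1 wt ord0 c.

Definition virtual_teacher (v : X * 'I_C -> R) (s : X * 'I_C) : 'rV[R]_C :=
  softmax (virtual_logits v s).

(* The label s.2 only seeds the iterated minimum, since min has no neutral
   element; the seed is one of the terms, so it does not affect the value. *)
Definition min_logit (s : X * 'I_C) : R :=
  \big[Num.min/z s.1 wt ord0 s.2]_(c < C) z s.1 wt ord0 c.

Definition kd_loss (B : nat) (v : X * 'I_C -> R) (b : 'I_B -> X * 'I_C)
    (w : 'rV[R]_d) : R :=
  B%:R^-1 * \sum_(i < B) KL (virtual_teacher v (b i)) (softmax (z (b i).1 w)).

(* Student parameters after n updates from wt; update number t (from 0) uses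
   the batch [batch t]. *)
Fixpoint student (B : nat) (v : X * 'I_C -> R) (eta : R)
    (batch : nat -> 'I_B -> X * 'I_C) (n : nat) : 'rV[R]_d :=
  if n is t.+1 then
    let w := student v eta batch t in
    w - eta *: gradient (kd_loss v (batch t)) w
  else wt.

End Distillation.

(* Main.v *)
(* For a fixed teacher p, the gradient in w of KL(p || softmax(z(w))) is
   J^T (softmax(z(w)) - p). Its norm is at most G |softmax(z(w)) - p|, since a
   matrix and its transpose have the same operator norm, and two points of the
   probability simplex are at distance at most sqrt 2. Each update thus moves
   the student by at most eta G sqrt 2, whatever the teacher and the batch. *)
Require Import Defs.
From mathcomp Require Import all_boot all_order all_algebra.
From mathcomp Require Import all_classical all_reals all_analysis.
From mathcomp Require Import ring lra.
Import Order.TTheory GRing.Theory Num.Theory.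
Import numFieldNormedType.Exports.

Set Implicit Arguments.
Unset Strict Implicit.
Unset Printing Implicit Defensive.

Local Open Scope ring_scope.

(** * Euclidean inner product, norm and operator norm *)

Section EuclideanNorm.
Context {R : realType}.
Implicit Types n m : nat.

Definition dot {n} (a b : 'rV[R]_n) : R := \sum_(j < n) a ord0 j * b ord0 j.

Lemma dot_mulmx n (a b : 'rV[R]_n) : dot a b = (a *m b^T) ord0 ord0.
Proof. by rewrite mxE; apply: eq_bigr => j _; rewrite mxE. Qed.

Lemma l2norm_ge0 n (a : 'rV[R]_n) : 0 <= l2norm a.
Proof. exact: sqrtr_ge0. Qed.

Lemma sqr_l2norm n (a : 'rV[R]_n) : l2norm a ^+ 2 = dot a a.
Proof.
rewrite sqr_sqrtr; last by apply: sumr_ge0 => j _; exact: sqr_ge0.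
by apply: eq_bigr => j _; rewrite expr2.
Qed.

Lemma l2norm_eq0 n (a : 'rV[R]_n) : l2norm a = 0 -> a = 0.
Proof.
move=> a0; have /esym a2 := sqr_l2norm a; rewrite a0 expr0n /= in a2.
apply/rowP => j; rewrite mxE; apply/eqP; rewrite -sqrf_eq0 expr2; apply/eqP.
have /psumr_eq0P : forall i : 'I_n, true -> 0 <= a ord0 i * a ord0 i.
  by move=> i _; exact: sqr_ge0.
exact.
Qed.

(** Cauchy-Schwarz: expanding the squared norm of [|b| a - |a| b] gives
    [2 |a| |b| (|a| |b| - dot a b) >= 0]. Cancelling [|a| |b|] requires both norms to be nonzero, so
    zero vectors are treated first. *)
Lemma dot_le n (a b : 'rV[R]_n) : dot a b <= l2norm a * l2norm b.
Proof.
have [/l2norm_eq0 ->|a0] := eqVneq (l2norm a) 0.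
  by rewrite dot_mulmx mul0mx mxE mulr_ge0 ?l2norm_ge0.
have [/l2norm_eq0 ->|b0] := eqVneq (l2norm b) 0.
  by rewrite dot_mulmx trmx0 mulmx0 mxE mulr_ge0 ?l2norm_ge0.
have A0 : 0 < l2norm a by rewrite lt_def a0 l2norm_ge0.
have B0 : 0 < l2norm b by rewrite lt_def b0 l2norm_ge0.
set A := l2norm a in A0 *; set B := l2norm b in B0 *.
have : 0 <= dot (B *: a - A *: b) (B *: a - A *: b).
  by rewrite -sqr_l2norm sqr_ge0.
have -> : dot (B *: a - A *: b) (B *: a - A *: b) =
   B ^+ 2 * dot a a + A ^+ 2 * dot b b - 2 * (A * B) * dot a b.
  rewrite /dot !mulr_sumr -big_split -sumrB /=.
  by apply: eq_bigr => j _; rewrite !mxE; ring.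
rewrite -!sqr_l2norm -/A -/B => H.
rewrite -(ler_pM2l (mulr_gt0 A0 B0)); nra.
Qed.

Lemma l2normZ n k (a : 'rV[R]_n) : l2norm (k *: a) = `|k| * l2norm a.
Proof.
rewrite /l2norm -sqrtr_sqr -sqrtrM ?sqr_ge0// mulr_sumr.
by congr Num.sqrt; apply: eq_bigr => j _; rewrite mxE exprMn.
Qed.

Lemma l2norm0 n : l2norm (0 : 'rV[R]_n) = 0.
Proof. by rewrite -(scale0r 0) l2normZ normr0 mul0r. Qed.

Lemma ler_l2normD n (a b : 'rV[R]_n) : l2norm (a + b) <= l2norm a + l2norm b.
Proof.
rewrite -(@ler_pXn2r _ 2) ?nnegrE ?addr_ge0 ?l2norm_ge0//.
rewrite sqrrD sqr_l2norm [leLHS](_ : _ = dot a a + dot a b *+ 2 + dot b b).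
  by rewrite !sqr_l2norm lerD2r lerD2l lerMn2r dot_le.
rewrite /dot -sumrMnl -!big_split; apply: eq_bigr => j _ /=.
by rewrite !mxE; ring.
Qed.

Lemma ler_l2norm_sum n (I : finType) (F : I -> 'rV[R]_n) :
  l2norm (\sum_i F i) <= \sum_i l2norm (F i).
Proof.
elim/big_ind2: _ => [|a x b y ax by_|//]; first by rewrite l2norm0.
exact: le_trans (ler_l2normD _ _) (lerD ax by_).
Qed.

(** By homogeneity it suffices to scale [v] to a unit vector, whose image is one of the values under
    the supremum. *)
Lemma ler_l2norm_opnorm m n (A : 'M[R]_(m, n)) (v : 'rV[R]_m) :
  l2norm (v *m A) <= opnorm A * l2norm v.
Proof.
have [/l2norm_eq0 ->|v0] := eqVneq (l2norm v) 0.
  by rewrite mul0mx !l2norm0 mulr0.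
have vgt0 : 0 < l2norm v by rewrite lt_def v0 l2norm_ge0.
rewrite -ler_pdivrMr// mulrC -(gtr0_norm vgt0) -normfV -l2normZ scalemxAl.
apply: ub_le_sup; last first.
  by exists ((l2norm v)^-1 *: v) => //=; rewrite l2normZ normfV gtr0_norm// mulVf.
(* The sup of an unbounded set is the junk value 0, so a bound is needed. *)
exists (\sum_i l2norm (row i A)) => _ [u /= u1 <-].
rewrite mulmx_sum_row (le_trans (ler_l2norm_sum _))// ler_sum// => i _.
rewrite l2normZ ler_piMl ?l2norm_ge0//.
(* A single coordinate satisfies [|u_i| = sqrt (u_i ^ 2) <= l2norm u]. *)
apply: le_trans u1; rewrite -sqrtr_sqr ler_wsqrtr//.
by rewrite (bigD1 i)//= lerDl sumr_ge0// => j _; exact: sqr_ge0.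
Qed.

(** With [g = a A^T], moving the transpose across the inner product gives
    [|g|^2 = dot a (g A) <= |a| G |g|], and one factor [|g|] cancels. Only the operator norm of [A]
    itself enters. *)
Lemma ler_l2norm_trmx m n (A : 'M[R]_(m, n)) (a : 'rV[R]_n) (G : R) :
  0 <= G -> opnorm A <= G -> l2norm (a *m A^T) <= G * l2norm a.
Proof.
move=> G0 AG; set g := a *m A^T.
have [->|g0] := eqVneq (l2norm g) 0; first by rewrite mulr_ge0 ?l2norm_ge0.
have ggt0 : 0 < l2norm g by rewrite lt_def g0 l2norm_ge0.
rewrite -(ler_pM2r ggt0) -expr2 sqr_l2norm.
have -> : dot g g = dot a (g *m A).
  by rewrite !dot_mulmx [(g *m A)^T]trmx_mul mulmxA.
rewrite (le_trans (dot_le _ _))// mulrAC [leRHS]mulrC ler_wpM2l ?l2norm_ge0//.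
by rewrite (le_trans (ler_l2norm_opnorm _ _))// ler_wpM2r ?l2norm_ge0.
Qed.

End EuclideanNorm.

(** * The probability simplex and softmax *)

Section Simplex.
Context {R : realType} {C : nat}.
Implicit Types p q u : 'rV[R]_C.

(** Coordinates lie in [[0, 1]], so [(p_c - q_c)^2 <= p_c + q_c]; the right-hand sides sum to 2. *)
Lemma ler_l2norm_simplex p q :
  (forall c, 0 <= p ord0 c) -> \sum_c p ord0 c = 1 ->
  (forall c, 0 <= q ord0 c) -> \sum_c q ord0 c = 1 ->
  l2norm (p - q) <= Num.sqrt 2.
Proof.
move=> p0 p1 q0 q1; rewrite ler_wsqrtr//.
have -> : 2 = \sum_c (p ord0 c + q ord0 c) :> R by rewrite big_split /= p1 q1.
have le1 (r : 'rV[R]_C) : (forall c, 0 <= r ord0 c) -> \sum_c r ord0 c = 1 ->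
    forall c, r ord0 c <= 1.
  by move=> r0 <- c; rewrite (bigD1 c)//= lerDl sumr_ge0.
apply: ler_sum => c _; rewrite !mxE.
have := p0 c; have := q0 c; have := le1 _ p0 p1 c; have := le1 _ q0 q1 c.
nra.
Qed.

Lemma sum_expR_gt0 u : (0 < C)%N -> 0 < \sum_c expR (u ord0 c).
Proof.
move=> C0; rewrite (bigD1 (Ordinal C0))//= ltr_wpDr ?expR_gt0//.
by apply: sumr_ge0 => i _; exact: expR_ge0.
Qed.

Lemma softmax_gt0 u c : 0 < softmax u ord0 c.
Proof.
rewrite mxE divr_gt0 ?expR_gt0 ?sum_expR_gt0//.
exact: leq_ltn_trans (ltn_ord c).
Qed.

Lemma sum_softmax u : (0 < C)%N -> \sum_c softmax u ord0 c = 1.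
Proof.
move=> C0; under eq_bigr do rewrite mxE.
by rewrite -mulr_suml divff// gt_eqF// sum_expR_gt0.
Qed.

(** Splits the divergence into a term free of [u], the log-sum-exp of [u], and a linear term, each
    easy to differentiate. *)
Lemma KL_softmax p u : (0 < C)%N -> (forall c, 0 < p ord0 c) ->
  \sum_c p ord0 c = 1 ->
  KL p (softmax u) = \sum_c p ord0 c * ln (p ord0 c)
    + ln (\sum_c expR (u ord0 c)) - dot p u.
Proof.
move=> C0 p0 p1.
(* As [p] has mass 1, the log-partition term can be distributed over the sum with weights [p_c]. *)
rewrite -[ln (\sum__ _)]mul1r -p1 mulr_suml -big_split /= -sumrB.
apply: eq_bigr => c _; rewrite mxE lnM ?posrE ?invr_gt0 ?divr_gt0 ?expR_gt0//;
  last exact: sum_expR_gt0.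
rewrite lnV ?posrE ?divr_gt0 ?expR_gt0 ?sum_expR_gt0//.
by rewrite ln_div ?posrE ?expR_gt0 ?sum_expR_gt0// expRK; ring.
Qed.

End Simplex.

(** * Directional derivatives of the divergence *)

Section Derivative.
Context {R : realType}.

Lemma is_derive_comp_real (V : normedModType R) (f : V -> R) (g : R -> R)
    (x v : V) (b : R) : differentiable f x -> is_derive (f x) 1 g b ->
  differentiable (g \o f) x /\ 'D_v (g \o f) x = b * 'D_v f x.
Proof.
move=> df [dg <-]; have dg' : differentiable g (f x) by apply/derivable1_diffP.
split; first exact: differentiable_comp.
rewrite [LHS]deriveE; last exact: differentiable_comp.
by rewrite diff_comp//= diff1E// derive1E (deriveE v df) [RHS]mulrC.
Qed.

Context {C d : nat}.

Lemma derive_coord (f : 'rV[R]_d -> 'rV[R]_C) (w h : 'rV[R]_d) c : differentiable f w ->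
  differentiable (fun w => f w ord0 c) w /\
  'D_h (fun w => f w ord0 c) w = (h *m 'J f w) ord0 c.
Proof.
move=> df; have dc : differentiable (fun w => f w ord0 c) w.
  by apply: (@differentiable_comp _ _ _ _ f (fun M => M ord0 c)) => //;
     exact: differentiable_coord.
split=> //.
have : derivable f w h by exact: diff_derivable.
by move=> /derive_mx; rewrite deriveEjacobian// => ->; rewrite mxE.
Qed.

(** The gradient of log-sum-exp is softmax, that of the linear term is [p], and the entropy term is
    constant; the chain rule then applies the Jacobian to the direction [h]. *)
Lemma derive_KL_softmax (f : 'rV[R]_d -> 'rV[R]_C) (p : 'rV[R]_C) (w h : 'rV[R]_d) :
  (0 < C)%N -> (forall c, 0 < p ord0 c) -> \sum_c p ord0 c = 1 ->
  differentiable f w ->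
  is_derive w h (fun w => KL p (softmax (f w)))
    (dot (softmax (f w) - p) (h *m 'J f w)).
Proof.
move=> C0 p0 p1 df.
(* The loss is recast as sums, scalings and compositions of functions, the shape to which the
   derivative rules apply. *)
rewrite (_ : (fun w => _) = cst (\sum_c p ord0 c * ln (p ord0 c))
    + (@ln R \o (\sum_(c < C) (expR \o (fun w => f w ord0 c))))
    - (\sum_(c < C) (p ord0 c *: (fun w => f w ord0 c)))); last first.
  apply/funext => u; rewrite KL_softmax//.
  rewrite !fctE /= !fct_sumE /=; congr (_ - _).
have dexp c := is_derive_comp_real h (derive_coord h c df).1
  (is_derive_expR (f w ord0 c)).
have [dln eln] : differentiable (@ln R \o
      (\sum_(c < C) (expR \o (fun w => f w ord0 c)))) w /\
    'D_h (@ln R \o (\sum_(c < C) (expR \o (fun w => f w ord0 c)))) w =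
     dot (softmax (f w)) (h *m 'J f w).
  have [|d1 ->] := is_derive_comp_real h
    (differentiable_sum (fun c => (dexp c).1))
    (is_derive1_ln (x := _) _).
    by rewrite fct_sumE sum_expR_gt0.
  split=> //; rewrite derive_sum; last first.
    by move=> c; apply: diff_derivable; exact: (dexp c).1.
  rewrite mulr_sumr; apply: eq_bigr => c _.
  rewrite (dexp c).2 (derive_coord _ _ df).2 fct_sumE [in RHS]mxE.
  by rewrite mulrA [X in X * _]mulrC.
have dc c : is_derive w h (fun w => f w ord0 c) ((h *m 'J f w) ord0 c).
  rewrite -(derive_coord _ _ df).2; apply/derivableP; apply: diff_derivable.
  exact: (derive_coord h _ df).1.
have dp := is_derive_sum (fun c => is_deriveZ (p ord0 c) (dc c)).
apply: (is_derive_eq (is_deriveB (is_deriveD (is_derive_cst _ w h)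
  (derivableP (diff_derivable (v := h) dln))) dp)).
rewrite eln add0r /dot -sumrB; apply: eq_bigr => c _.
by rewrite !mxE mulrBl.
Qed.

End Derivative.

(** * Gradient of the distillation loss and drift of the student *)

Section Distillation.
Context {R : realType} {X : Type} {C d : nat}.
Variables (z : X -> 'rV[R]_d -> 'rV[R]_C) (wt : 'rV[R]_d).
Hypothesis hz : forall x w, differentiable (z x) w.

(** The teacher is computed from [wt], so it stays constant while [w] varies, and the derivative can
    be taken sample by sample. *)
Lemma gradient_kd_loss B (v : X * 'I_C -> R) (b : 'I_B -> X * 'I_C) w :
  gradient (kd_loss z wt v b) w =
  B%:R^-1 *: \sum_i (softmax (z (b i).1 w) - virtual_teacher z wt v (b i))
                    *m ('J (z (b i).1) w)^T.
Proof.
apply/rowP => j; rewrite !mxE summxE.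
pose L i w := KL (virtual_teacher z wt v (b i)) (softmax (z (b i).1 w)).
have -> : kd_loss z wt v b = B%:R^-1 *: \sum_i L i.
  by apply/funext => u; rewrite fctE fct_sumE.
have dL i : is_derive w (delta_mx ord0 j) (L i)
    (dot (softmax (z (b i).1 w) - virtual_teacher z wt v (b i))
         (delta_mx ord0 j *m 'J (z (b i).1) w)).
  (* The label of the sample inhabits ['I_C]. *)
  have C0 : (0 < C)%N by exact: leq_ltn_trans (ltn_ord (b i).2).
  apply: derive_KL_softmax => //; first by move=> c; exact: softmax_gt0.
  exact: sum_softmax.
have [_ ->] := is_deriveZ B%:R^-1 (is_derive_sum dL).
(* A basis vector times the Jacobian is its row [j]; pairing with that row is coordinate [j] of the
   product with the transpose. *)
congr (_ * _); apply: eq_bigr => i _; rewrite -rowE /dot [RHS]mxE.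
by apply: eq_bigr => c _; rewrite !mxE.
Qed.

(** The gradient is an average of [B] vectors, each the image under a transposed Jacobian of a
    difference of two simplex points. *)
Lemma ler_l2norm_gradient_kd_loss (G : R) B (v : X * 'I_C -> R)
    (b : 'I_B -> X * 'I_C) w :
  0 <= G -> (forall x, opnorm ('J (z x) w) <= G) -> (0 < B)%N ->
  l2norm (gradient (kd_loss z wt v b) w) <= G * Num.sqrt 2.
Proof.
move=> G0 hJ B0; rewrite gradient_kd_loss l2normZ ger0_norm ?invr_ge0//.
rewrite mulrC ler_pdivrMr ?ltr0n// (le_trans (ler_l2norm_sum _))//.
rewrite mulr_natr -[in leRHS](card_ord B) -sumr_const; apply: ler_sum => i _.
have C0 : (0 < C)%N by exact: leq_ltn_trans (ltn_ord (b i).2).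
rewrite (le_trans (ler_l2norm_trmx _ G0 (hJ _)))// ler_wpM2l//.
by apply: ler_l2norm_simplex; rewrite ?sum_softmax// => c;
  rewrite ltW// softmax_gt0.
Qed.

(** Induction on the number of updates with the triangle inequality. The gradient bound is uniform
    in the current parameters, the batch and the rule [v], so one statement covers the fixed logit
    and the minimum logit. *)
Lemma ler_l2norm_student (G eta : R) B (v : X * 'I_C -> R)
    (batch : nat -> 'I_B -> X * 'I_C) T :
  0 <= G -> (forall x w, opnorm ('J (z x) w) <= G) -> 0 <= eta -> (0 < B)%N ->
  l2norm (student z wt v eta batch T - wt) <= eta * G * Num.sqrt 2 * T%:R.
Proof.
move=> G0 hJ eta0 B0; elim: T => [|T IH] /=.
  by rewrite subrr l2norm0 mulr0.
rewrite addrAC (le_trans (ler_l2normD _ _))// -[T.+1%:R]natr1 mulrDr mulr1 lerD//.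
rewrite -scaleNr l2normZ normrN ger0_norm// -mulrA ler_wpM2l//.
exact: ler_l2norm_gradient_kd_loss.
Qed.

End Distillation.

Theorem lemma2 (R : realType) (X : Type) (C d : nat)
    (z : X -> 'rV[R]_d -> 'rV[R]_C)
    (hz : forall (x : X) (w : 'rV[R]_d), differentiable (z x) w)
    (G : R) (hG : 0 < G)
    (hJ : forall (x : X) (w : 'rV[R]_d), opnorm ('J (z x) w) <= G)
    (wt : 'rV[R]_d) (eta : R) (heta : 0 < eta)
    (B : nat) (hB : (0 < B)%N) (Tu : nat)
    (batch : nat -> 'I_B -> X * 'I_C) :
  (forall v : R,
     l2norm (student z wt (fun=> v) eta batch Tu - wt)
       <= eta * G * Num.sqrt 2 * Tu%:R) /\
  l2norm (student z wt (min_logit z wt) eta batch Tu - wt)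
    <= eta * G * Num.sqrt 2 * Tu%:R.
Proof. by split=> [v|]; apply: ler_l2norm_student => //; exact: ltW. Qed.
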